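(* Let $s\ge 1$ and consider an $s$-stage explicit Runge--Kutta scheme with real coefficients $a_{ik}$, $0\le k<i\le s$ (where $a_{sj}=b_j$ are the weights). If $a_{ik}>0$ for all $0\le k<i\le s$, then there exist coefficients $\alpha_{ik},\beta_{ik}\ge 0$ ($0\le k<i\le s$) such that the scheme satisfies the RK-SSP condition with these coefficients.
   Context: An $s$-stage explicit Runge--Kutta scheme for an ODE system $u'=G(u)$ with time step $\tau$ and coefficients $a_{ik}$ ($0\le k<i\le s$) is $$v_0=u_n,\qquad v_i=u_n+\tau\sum_{j=0}^{i-1}a_{ij}G(v_j)\quad(1\le i\le s),\qquad u_{n+1}=v_s,$$ where the last row is $a_{sj}=b_j$, with $b_j$ the weights of the Butcher tableau. The strictly lower-triangular matrix $A_L$ is the $(s+1)\times(s+1)$ matrix, with rows and columns indexed by $0,\dots,s$, whose entries below the diagonal are $a_{ik}$, $0\le k<i\le s$, all other entries being zero. Shu--Osher form: given numbers $\alpha_{ik}$ ($0\le k<i\le s$) with $\sum_{k=0}^{i-1}\alpha_{ik}=1$ for $1\le i\le s$, the scheme can be rewritten as $$v_0=u_n,\qquad v_i=\sum_{k=0}^{i-1}\bigl(\alpha_{ik}v_k+\tau\beta_{ik}G(v_k)\bigr)\quad(1\le i\le s),\qquad u_{n+1}=v_s,$$ where $$\beta_{ik}=a_{ik}-\sum_{j=k+1}^{i-1}\alpha_{ij}a_{jk},\qquad 0\le k\le i-1 .$$ The scheme satisfies the RK-SSP condition (with coefficients $\alpha_{ik},\beta_{ik}$, where $\beta_{ik}$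 is given by $\beta_{ik}=a_{ik}-\sum_{j=k+1}^{i-1}\alpha_{ij}a_{jk}$ for $0\le k\le i-1$) if $\sum_{k=0}^{i-1}\alpha_{ik}=1$ for $1\le i\le s$, and $\alpha_{ik}\ge 0$, $\beta_{ik}\ge 0$ for all $0\le k<i\le s$, and $\beta_{ik}=0$ whenever $\alpha_{ik}=0$. *)

(* Defs.v *)
From HB Require Import structures.
From mathcomp Require Import all_boot all_order all_algebra.
From mathcomp Require Import reals.

Set Implicit Arguments.
Unset Strict Implicit.
Unset Printing Implicit Defensive.

Import Order.TTheory GRing.Theory Num.Theory.
Local Open Scope ring_scope.

(* An s-stage explicit Runge-Kutta scheme is given by its (s+1) x (s+1) matrix
   A_L, with rows and columns indexed by 0, ..., s: entry (i, k) with k < i is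
   a_(ik), row s being the weights b of the Butcher tableau. *)
Definition strictly_lower (R : realType) (s : nat) (A : 'M[R]_s.+1) : Prop :=
  forall i k : 'I_s.+1, (i <= k)%N -> A i k = 0.

(* Only the entries (i, k) with k < i of alpha and beta are meaningful.
   beta i k is the coefficient of tau * G(v_k) in stage i once the scheme is
   rewritten as v_i = \sum_(k < i) (alpha i k * v_k + tau * beta i k * G(v_k)). *)
Definition shu_osher_beta (R : realType) (s : nat) (A alpha : 'M[R]_s.+1)
    (i k : 'I_s.+1) : R :=
  A i k - \sum_(j < s.+1 | (k < j < i)%N) alpha i j * A j k.

Definition rk_ssp (R : realType) (s : nat) (A alpha beta : 'M[R]_s.+1) : Prop :=
  [/\ forall i k : 'I_s.+1, (k < i)%N -> beta i k = shu_osher_beta A alpha i k,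
      forall i : 'I_s.+1, (1 <= i)%N -> \sum_(k < s.+1 | (k < i)%N) alpha i k = 1,
      forall i k : 'I_s.+1, (k < i)%N -> 0 <= alpha i k,
      forall i k : 'I_s.+1, (k < i)%N -> 0 <= beta i k
    & forall i k : 'I_s.+1, (k < i)%N -> alpha i k = 0 -> beta i k = 0].

(* Main.v *)
Require Import Defs.
From HB Require Import structures.
From mathcomp Require Import all_boot all_order all_algebra.
From mathcomp Require Import reals.

Import Order.TTheory GRing.Theory Num.Theory.
Local Open Scope ring_scope.

(** Take [alpha i k = e] for [0 < k < i] and put the remaining mass
    [1 - (i - 1) e] on [k = 0].  The sum defining [beta i k] only involves
    [alpha i j] with [j > 0], so [beta i k = A i k - e * \sum_(k < j < i) A j k].
    For [e] small all [alpha i k] are positive and all [beta i k] nonnegative,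
    and the condition on vanishing [alpha i k] is vacuous. *)

Lemma ler_sum_term {R : numDomainType} {I : finType} (P : pred I) (F : I -> R)
    (i : I) :
  P i -> (forall j, P j -> 0 <= F j) -> F i <= \sum_(j | P j) F j.
Proof.
move=> Pi F0; rewrite (bigD1 i) //= lerDl sumr_ge0 // => j /andP[Pj _].
exact: F0.
Qed.

Lemma small_step_exists {R : realFieldType} {s : nat} (A : 'M[R]_s.+1) :
  (forall i k : 'I_s.+1, (k < i)%N -> 0 < A i k) ->
  exists e : R, [/\ 0 < e, e * s.+1%:R <= 1 &
    forall i k : 'I_s.+1, (k < i)%N ->
      e * (\sum_(j < s.+1 | (k < j < i)%N) A j k) <= A i k].
Proof.
move=> hpos.
pose q (p : 'I_s.+1 * 'I_s.+1) :=
  (\sum_(j < s.+1 | (p.2 < j < p.1)%N) A j p.2) / A p.1 p.2.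
have q0 (p : 'I_s.+1 * 'I_s.+1) : (p.2 < p.1)%N -> 0 <= q p.
  move=> lt_p; apply: divr_ge0; last exact/ltW/hpos.
  by apply: sumr_ge0 => j /andP[kj _]; apply/ltW/hpos.
pose Q := \sum_(p : 'I_s.+1 * 'I_s.+1 | (p.2 < p.1)%N) q p.
have Q0 : 0 <= Q by apply: sumr_ge0.
have D0 : 0 < s.+1%:R + Q by rewrite ltr_wpDr // ltr0Sn.
exists (s.+1%:R + Q)^-1; split; first by rewrite invr_gt0.
  by rewrite ler_pdivrMl // mulr1 lerDl.
move=> i k ki; rewrite ler_pdivrMl // -ler_pdivrMr ?hpos //.
apply: (@le_trans _ _ Q); last by rewrite lerDr ler0n.
exact: (@ler_sum_term _ _ (fun p : 'I_s.+1 * 'I_s.+1 => (p.2 < p.1)%N) q (i, k)).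
Qed.

Theorem theorem2 (R : realType) (s : nat) (hs : (1 <= s)%N) (A : 'M[R]_s.+1)
    (hA : strictly_lower A)
    (hpos : forall i k : 'I_s.+1, (k < i)%N -> 0 < A i k) :
  exists alpha beta : 'M[R]_s.+1, rk_ssp A alpha beta.
Proof.
have [e [e0 es hbeta]] := small_step_exists A hpos.
pose alpha : 'M[R]_s.+1 := \matrix_(i, k)
  if k == ord0 then 1 - \sum_(j < s.+1 | (j < i)%N && (j != ord0)) e else e.
have alpha_gt0 i k : 0 < alpha i k.
  rewrite mxE; case: ifP => // _; rewrite subr_gt0.
  apply: lt_le_trans es.
  have -> : e * s.+1%:R = \sum_(j < s.+1) e by rewrite sumr_const card_ord mulr_natr.
  (* Strictness comes from index 0, which the left sum omits and which contributes [e > 0] on the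
     right. *)
  rewrite (bigD1 ord0 (P := predT)) //= [ltRHS]addrC big_mkcondl /=.
  apply: ltr_pwDr => //.
  by apply: ler_sum => j _; case: ifP => // _; apply: ltW.
exists alpha, (\matrix_(i, k) shu_osher_beta A alpha i k); split.
- by move=> i k _; rewrite mxE.
- move=> i i0; rewrite (bigD1 ord0) //= mxE eqxx.
  rewrite [X in _ + X](eq_bigr (fun=> e)) ?subrK // => j /andP[_ j0].
  by rewrite mxE (negPf j0).
- by move=> i k _; apply: ltW.
- move=> i k ki; rewrite mxE /shu_osher_beta subr_ge0.
  apply: le_trans (hbeta i k ki); rewrite mulr_sumr.
  (* Since [k < j] forces [j] to be nonzero, [alpha i j] is [e] and never the entry of column 0. *)
  rewrite (eq_bigr (fun j => e * A j k)) // => j /andP[kj _].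
  by rewrite mxE -val_eqE /= gtn_eqF // (leq_ltn_trans _ kj).
- by move=> i k _ a0; move: (alpha_gt0 i k); rewrite a0 ltxx.
Qed.
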